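(* Let $G=\langle\sigma,\tau\rangle$ be the Klein four-group, let $\Bbbk$ be a field of characteristic $2$, and let $\chi=\{\langle\sigma\rangle,\langle\tau\rangle,\langle\sigma\tau\rangle\}$. Let $N$ be an even-dimensional indecomposable $\Bbbk G$-module which is not projective relative to $\chi$. If $N\cong V_{2n,\infty}$, or $N\cong V_{2n,\theta}$ with $\theta(x)=x^n$ or $\theta(x)=(x+1)^n$, then $$\dim H^i_\chi(G,N)=\begin{cases} n & i=0,\\ n-1 & i>0.\end{cases}$$ If $N\cong V_{2n,\theta}$ for some other choice of $\theta$, then $\dim H^i_\chi(G,N)=n$ for all $i\ge 0$.
   Context: All modules are finitely generated. Put $X=\sigma-1$, $Y=\tau-1\in\Bbbk G$, so $\Bbbk G\cong\Bbbk[X,Y]/(X^2,Y^2)$. For $n\ge1$, $V_{2n,\infty}$ is the $2n$-dimensional module with basis $a_1,\dots,a_n,b_1,\dots,b_n$ and $Xa_i=b_i$ ($1\le i\le n$), $Ya_i=b_{i+1}$ ($1\le i\le n-1$), $Ya_n=0$, $Xb_i=Yb_i=0$. For $n\ge1$ and $\theta(x)=\sum_{i=0}^n\lambda_i x^{n-i}$ a power of a monic irreducible polynomial over $\Bbbk$ (of degree $n$), $V_{2n,\theta}$ is the $2n$-dimensional module with basis $a_1,\dots,a_n,b_1,\dots,b_n$ and $Ya_i=b_i$ ($1\le i\le n$), $Xa_{i+1}=b_i$ ($1\le i\le n-1$), $Xa_1=\sum_{i=1}^n\lambda_i b_i$, $Xb_i=Yb_i=0$. A $\Bbbk G$-module $M$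 is projective relative to $\chi$ if it is a direct summand of $\bigoplus_{H\in\chi} M\downarrow_H\uparrow^G$. Relative cohomology $H^i_\chi(G,N)=\mathrm{Ext}^i_{\Bbbk G,\chi}(\Bbbk,N)$ is the $i$-th homology of the complex $0\to\mathrm{Hom}_{\Bbbk G}(Q_0,N)\to\mathrm{Hom}_{\Bbbk G}(Q_1,N)\to\cdots$, where $\cdots\to Q_1\to Q_0\to\Bbbk\to 0$ is a relative projective resolution of the trivial module: an exact complex in which each $Q_i$ is projective relative to $\chi$ and the connecting homomorphisms split over each $H\in\chi$ (i.e. the complex is split exact on restriction to each $H\in\chi$). It is independent of the choice of resolution. *)

(* Defs.v *)
From mathcomp Require Import all_boot all_order all_fingroup all_algebra.
From mathcomp Require Import all_solvable all_field all_character.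

Set Implicit Arguments.
Unset Strict Implicit.
Unset Printing Implicit Defensive.

Import GroupScope GRing.Theory.
Local Open Scope ring_scope.

(* A finitely generated kG-module is a matrix representation; matrices act on
   row vectors from the right, so the product f *m g is "f, then g".  The
   group G is the whole of gT.  Direct sums are those of character.v
   (dadd_grepr), isomorphism is mx_rsim. *)

Section HomSpace.

Variables (k : fieldType) (gT : finGroupType) (K : {group gT}).

Definition hom_space (A B : representation k K) :
    {vspace 'M[k]_(rdegree A, rdegree B)} :=
  (\bigcap_(g in K) lker (linfun (mulmx (A g) \- mulmxr (B g))))%VS.

Lemma hom_spaceP (A B : representation k K) f :
  reflect (forall g, g \in K -> A g *m f = f *m B g) (f \in hom_space A B).
Proof.
apply: (iffP idP) => [|homf]; last first.
  rewrite /hom_space memvE; apply/subv_bigcapP => g Kg; rewrite -memvE memv_ker.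
  by rewrite lfunE /= homf // subrr.
rewrite memvE => /subv_bigcapP sf g /sf; rewrite -memvE memv_ker lfunE /=.
by rewrite subr_eq0 => /eqP.
Qed.

Lemma triv_mx_repr : mx_repr K (fun _ : gT => 1%:M : 'M[k]_1).
Proof. by split=> // g h _ _; rewrite mulmx1. Qed.

Definition triv_repr : representation k K :=
  Representation (MxRepresentation triv_mx_repr).

Definition indecomposable (M : representation k K) : Prop :=
  (0 < rdegree M)%N /\
  forall A B : representation k K, mx_rsim M (dadd_grepr A B) ->
    rdegree A = 0%N \/ rdegree B = 0%N.

End HomSpace.

Section ResInd.

Variables (k : fieldType) (gT : finGroupType).
Local Notation G := [set: gT]%G.

Definition res_repr (H : {group gT}) (M : representation k G) :
    representation k H :=
  Representation (subg_repr M (subsetT H)).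

Section Ind.

Variables (H : {group gT}) (W : representation k H).

Definition coset_rep (i : 'I_#|rcosets H [set: gT]|) : gT := repr (enum_val i).

Definition ext0 (x : gT) : 'M[k]_(rdegree W) := if x \in H then W x else 0.

(* The representation on the tensor product of W with kG over kH, in the basis
   w (x) r with w in a basis of W and r running over representatives of the
   right cosets of H: (w (x) r_i) g = w (r_i g r_j^-1) (x) r_j for the unique j
   such that r_i g r_j^-1 lies in H. *)
Definition ind_mx (g : gT) :=
  \mxblock_(i < #|rcosets H [set: gT]|, j < #|rcosets H [set: gT]|)
     ext0 (coset_rep i * g * (coset_rep j)^-1)%g.

Lemma coset_rep_enum i : H :* coset_rep i = enum_val i.
Proof.
rewrite /coset_rep; have /rcosetsP[x _ ->] := enum_valP i.
by apply/rcoset_eqP; rewrite mem_repr_rcoset.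
Qed.

Lemma coset_rep_inj i j :
  (coset_rep i * (coset_rep j)^-1 \in H)%g = (i == j).
Proof.
rewrite -mem_rcoset coset_rep_enum.
apply/idP/eqP => [ij | ->]; last first.
  by rewrite -coset_rep_enum rcoset_refl.
apply: enum_val_inj; rewrite -!coset_rep_enum; apply/rcoset_eqP.
by rewrite coset_rep_enum.
Qed.

Lemma coset_rep_ex x : exists i, (x * (coset_rep i)^-1 \in H)%g.
Proof.
have Hx : H :* x \in rcosets H [set: gT] by apply/rcosetsP; exists x; rewrite ?inE.
exists (enum_rank_in Hx (H :* x)).
by rewrite -mem_rcoset coset_rep_enum enum_rankK_in // rcoset_refl.
Qed.

Lemma ind_mx_repr : mx_repr G ind_mx.
Proof.
split=> [|x y _ _].
  apply/mxblockP => i j; rewrite /ind_mx mxblockK mulg1 /ext0 coset_rep_inj.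
  apply/matrixP => a b; rewrite /submxblock !mxE.
  rewrite [_ == tagnat.Rank _ _](@tagnat.eq_Rank _ (fun=> rdegree W) i j a b).
  case: eqVneq => [<-|_]; last by rewrite mxE.
  by rewrite mulgV repr_mx1 mxE.
rewrite /ind_mx mul_mxblock; apply/eq_mxblockP => i j.
have [l Hl] := coset_rep_ex (coset_rep i * x)%g.
rewrite (bigD1 l) //= big1 ?addr0 => [|l' ne_l'l]; last first.
  rewrite /ext0; case: ifP => [Hl'|]; last by rewrite mul0mx.
  case/eqP: ne_l'l; apply/eqP; rewrite -coset_rep_inj.
  by rewrite -(groupMl _ Hl') !mulgA mulgKV.
set a := (_ * x * _)%g in Hl *; set b := (_ * y * _)%g.
have -> : (coset_rep i * (x * y) * (coset_rep j)^-1 = a * b)%g.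
  by rewrite /a /b !mulgA mulgKV.
rewrite /ext0 Hl groupMl //; case: ifP => Hb; last by rewrite mulmx0.
by rewrite repr_mxM.
Qed.

Definition ind_repr : representation k G :=
  Representation (MxRepresentation ind_mx_repr).

End Ind.

End ResInd.

Section RelativeCohomology.

Variables (k : fieldType) (gT : finGroupType).
Local Notation G := [set: gT]%G.
Local Notation kGmod := (representation k G).

Variable chi : {set {group gT}}.

Definition rel_projective (M : kGmod) : Prop :=
  exists M' : kGmod,
    mx_rsim (\big[@dadd_grepr k gT G/@grepr0 k gT G]_(H in chi)
               ind_repr (res_repr H M))
            (dadd_grepr M M').

(* A differential d splits when d = d s d for some s. *)
Definition splits_over (H : {group gT}) (A B : kGmod)
    (d : 'M[k]_(rdegree A, rdegree B)) : Prop :=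
  exists2 s, s \in hom_space (res_repr H B) (res_repr H A) & d *m s *m d = d.

Record rel_resolution := RelResolution {
  rres :> nat -> kGmod;
  rres_d : forall i, 'M[k]_(rdegree (rres i.+1), rdegree (rres i));
  rres_aug : 'M[k]_(rdegree (rres 0), rdegree (triv_repr k G));
  rres_proj : forall i, rel_projective (rres i);
  rres_d_hom : forall i, rres_d i \in hom_space (rres i.+1) (rres i);
  rres_aug_hom : rres_aug \in hom_space (rres 0) (triv_repr k G);
  rres_d_exact : forall i, (rres_d i.+1 :=: kermx (rres_d i))%MS;
  rres_aug_exact : (rres_d 0 :=: kermx rres_aug)%MS;
  rres_aug_onto : row_full rres_aug;
  rres_d_split : forall H i, H \in chi -> splits_over H (rres_d i);
  rres_aug_split : forall H, H \in chi -> splits_over H rres_aug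
}.

Section Cochains.

Variables (Q : rel_resolution) (N : kGmod).

Definition cobound (i : nat) :
    'Hom('M[k]_(rdegree (Q i), rdegree N), 'M[k]_(rdegree (Q i.+1), rdegree N)) :=
  linfun (mulmx (rres_d Q i)).

Definition cocycles (i : nat) : {vspace 'M[k]_(rdegree (Q i), rdegree N)} :=
  (hom_space (Q i) N :&: lker (cobound i))%VS.

Definition coboundaries (i : nat) : {vspace 'M[k]_(rdegree (Q i), rdegree N)} :=
  match i with
  | 0 => 0%VS
  | j.+1 => (cobound j @: hom_space (Q j) N)%VS
  end.

(* A complement of the coboundaries in the cocycles, as a model of the
   quotient space. *)
Definition cohomology (i : nat) : {vspace 'M[k]_(rdegree (Q i), rdegree N)} :=
  (cocycles i :\: coboundaries i)%VS.

End Cochains.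

(* The cohomology is defined by any relative projective resolution of the
   trivial module; existence is required so that the universally quantified
   clause is not vacuous. *)
Definition rel_cohomology_dim (N : kGmod) (i d : nat) : Prop :=
  inhabited rel_resolution /\
  forall Q : rel_resolution, \dim (cohomology Q N i) = d.

End RelativeCohomology.

Section KleinFour.

Variable gT : finGroupType.

Definition klein4 (s t : gT) : Prop :=
  [/\ 2.-abelem [set: gT], #|[set: gT]| = 4%N & <<[set s; t]>> = [set: gT]].

Definition klein4_chi (s t : gT) : {set {group gT}} :=
  [set <[s]>%G; <[t]>%G; <[(s * t)%g]>%G].

Variables (s t : gT) (Gst : klein4 s t).
Variables (k : fieldType) (k2 : 2%N \in [pchar k]).
Local Notation G := [set: gT]%G.

Lemma klein4_enum :
  [/\ forall g : gT, [|| g == 1, g == s, g == t | g == s * t]%g,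
      uniq [:: 1; s; t; s * t]%g, s * s = 1, t * t = 1 & t * s = s * t]%g.
Proof.
case: Gst => abG oG genG.
have sq (x : gT) : (x * x = 1)%g.
  by case/(abelemP (isT : prime 2)): abG => _ /(_ x (in_setT x)); rewrite expgS expg1.
have cc (x y : gT) : (x * y = y * x)%g.
  by apply: (centsP (abelem_abelian abG)); rewrite inE.
pose L := [:: 1; s; t; s * t]%g.
have LG : group_set [set x in L].
  apply/group_setP; split=> [|x y]; first by rewrite !inE eqxx.
  have e1 : (s * (s * t) = t)%g by rewrite mulgA sq mul1g.
  have e2 : (s * t * s = t)%g by rewrite cc mulgA sq mul1g.
  have e3 : (t * (s * t) = s)%g by rewrite (cc s) mulgA sq mul1g.
  have e4 : (s * t * t = s)%g by rewrite -mulgA sq mulg1.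
  rewrite !inE; do !case/orP; move=> /eqP ->; do !case/orP; move=> /eqP ->;
  by rewrite ?mul1g ?mulg1 ?sq ?e1 ?e2 ?e3 ?e4 ?(cc t s) ?eqxx ?orbT.
have allL (g : gT) : g \in L.
  have sub : <<[set s; t]>>%g \subset Group LG.
    by rewrite gen_subG; apply/subsetP => x; rewrite !inE => /orP[] ->; rewrite ?orbT.
  have := subsetP sub g; rewrite genG !inE => /(_ isT); exact.
split=> //; first by move=> g; have := allL g; rewrite !inE.
apply/card_uniqP; rewrite /= -[RHS]oG; apply: eq_card => x.
by rewrite !inE; have := allL x; rewrite !inE => ->.
Qed.

(* The kG-module on a_1..a_n, b_1..b_n (in this order) on which s - 1 and t - 1
   kill every b_i and send a_i to the combination of the b_j given by row i of
   A and of B respectively. *)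
Section TwoStep.

Variables (n : nat) (A B : 'M[k]_n).

Definition two_step_mx (g : gT) : 'M[k]_(n + n) :=
  block_mx 1%:M (((g == s) || (g == s * t)%g)%:R *: A
                 + ((g == t) || (g == s * t)%g)%:R *: B)
           0 1%:M.

Lemma two_step_mx_repr : mx_repr G two_step_mx.
Proof.
have [cov] := klein4_enum; rewrite /= !inE !negb_or !andbT.
move=> /and3P[/and3P[n1s n1t n1u] /andP[nst nsu] ntu] ss tt ts.
have A2 (C : 'M[k]_n) : C + C = 0.
  by rewrite -[C]scale1r -scalerDl -mulr2n (pcharf0 k2) scale0r.
have e1 : (s * (s * t) = t)%g by rewrite mulgA ss mul1g.
have e2 : (s * t * s = t)%g by rewrite -ts -mulgA ss mulg1.
have e3 : (t * (s * t) = s)%g by rewrite -ts mulgA tt mul1g.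
have e4 : (s * t * t = s)%g by rewrite -mulgA tt mulg1.
have e5 : (s * t * (s * t) = 1)%g by rewrite mulgA e2.
have ne := (negPf n1s, negPf n1t, negPf n1u, negPf nst, negPf nsu, negPf ntu).
have nts : (t == s) = false by rewrite eq_sym (negPf nst).
have nus : (s * t == s)%g = false by rewrite eq_sym (negPf nsu).
have nut : (s * t == t)%g = false by rewrite eq_sym (negPf ntu).
split=> [|x y _ _].
  by rewrite /two_step_mx !ne !scale0r addr0 -scalar_mx_block.
rewrite /two_step_mx mulmx_block !mulmx0 !mul0mx !mul1mx !mulmx1 !addr0 !add0r.
congr block_mx.
have := cov x; have := cov y.
do !case/orP; move=> /eqP ->; do !case/orP; move=> /eqP ->;
rewrite ?mul1g ?mulg1 ?ss ?tt ?e1 ?e2 ?e3 ?e4 ?e5 ?ts ?eqxx ?ne ?nts ?nus ?nut ?orbT /=;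
rewrite ?scale0r ?scale1r ?addr0 ?add0r ?A2 //.
- by rewrite addrA A2 add0r.
- by rewrite addrC.
- by rewrite addrCA A2 addr0.
- by rewrite addrAC A2 add0r.
- by rewrite -addrA A2 addr0.
Qed.

Definition two_step_repr : representation k G :=
  Representation (MxRepresentation two_step_mx_repr).

Lemma two_step_s : two_step_mx s - 1%:M = block_mx 0 A 0 0.
Proof.
have [_] := klein4_enum; rewrite /= !inE !negb_or !andbT.
move=> /and3P[/and3P[n1s n1t n1u] /andP[nst nsu] ntu] _ _ _.
rewrite /two_step_mx eqxx (negPf nst) (negPf nsu) scale1r scale0r addr0.
by rewrite scalar_mx_block opp_block_mx add_block_mx !subrr !subr0.
Qed.

Lemma two_step_t : two_step_mx t - 1%:M = block_mx 0 B 0 0.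
Proof.
have [_] := klein4_enum; rewrite /= !inE !negb_or !andbT.
move=> /and3P[/and3P[n1s n1t n1u] /andP[nst nsu] ntu] _ _ _.
rewrite /two_step_mx eqxx eq_sym (negPf nst) (negPf ntu) scale1r scale0r add0r.
by rewrite scalar_mx_block opp_block_mx add_block_mx !subrr !subr0.
Qed.

End TwoStep.

(* Indices of 'I_n start at 0: row i is a_(i+1), column j is b_(j+1). *)
Definition V_infty (n : nat) : representation k G :=
  two_step_repr 1%:M (\matrix_(i < n, j < n) (j == i.+1 :> nat)%:R).

(* With theta = sum_i lambda_i x^(n - i), row 0 is (lambda_1, ..., lambda_n). *)
Definition V_theta (n : nat) (theta : {poly k}) : representation k G :=
  two_step_repr
    (\matrix_(i < n, j < n)
       if i == 0%N :> nat then theta`_(n - j.+1) else (i == j.+1 :> nat)%:R)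
    1%:M.

Definition irr_power (n : nat) (theta : {poly k}) : Prop :=
  size theta = n.+1 /\
  exists (p : {poly k}) (e : nat),
    [/\ p \is monic, irreducible_poly p & theta = p ^+ e].

End KleinFour.

(* Main.v *)
Require Import Defs.
From mathcomp Require Import all_boot all_order all_fingroup all_algebra.
From mathcomp Require Import all_solvable all_field all_character.
From mathcomp Require Import zify.

Set Implicit Arguments.
Unset Strict Implicit.
Unset Printing Implicit Defensive.

Import GroupScope GRing.Theory.
Local Open Scope ring_scope.

(** Write [G] for the Klein four-group and pick generators [x], [y] such that
  [N] is free over [<[y]>] and over [<[x * y]>].  Tensoring [N] with the exact
  sequence [0 -> k -> k(G/<x>) -> k -> 0] gives [0 -> N -> J -> N -> 0], where
  [J] is induced from the restriction of [N] to [<[x]>].  This sequence splits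
  over [<[x]>] because [J] is induced from there, and over the other two
  subgroups because [N] is free over them.  Since [J] is relatively injective,
  the long exact sequence shifts the degree by one and gives, for all [i > 0],
  [dim H^i(G, N) = 2 dim N^G - dim N^x].

  The proof below carries this out without [J].  By Frobenius reciprocity
  [Hom_G(Q, J)] is [Hom_<x>(Q, N)], and the map to [Hom_G(Q, N)] becomes the
  transfer [f |-> f + y f y].  For each term [Q] of a resolution its kernel on
  [Hom_<x>(Q, N)] is [Hom_G(Q, N)] ([transfer_ker]) and it is onto
  ([transfer_onto]): by Higman's criterion the identity of [Q] is a sum of
  relative traces from the three subgroups, and a trace from a subgroup over
  which [N] is free is a trace from the trivial group, hence from [<[x]>].  As
  the resolution splits over [<[x]>], the complexes [Hom_<x>(Q, N)] are exact
  in positive degrees, and a dimension count replaces the long exact sequence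
  ([dim_cohomology_S]).  The count applies to any resolution, so that no
  comparison of resolutions is made.

  If [x], [y] send [(a, b)] to [(a, a D + b)] and [(a, a E + b)], with [E] and
  [D + E] invertible, then [dim N^G = n] and [dim N^x = 2n - rank D], so the
  dimension is the rank of [D] ([two_step_cohomology]).  For [V_theta] with
  [theta(1) != 0] take [(x, y) = (s, t)], where [D] is a companion matrix of
  [theta]; its rank is [n] or [n - 1] according as [theta(0)] is nonzero or
  zero.  For [theta = (X + 1)^n] take [(s t, t)], and for [V_infty] take
  [(t, s)].

  A resolution exists because the sum of the counits from the modules induced
  from the restrictions of [M] to the subgroups is a relatively split
  surjection onto [M], which can be iterated on the kernels. *)

(** * Homomorphisms and direct sums of representations *)

Section HomSpaceTheory.

Variables (k : fieldType) (gT : finGroupType) (K : {group gT}).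
Implicit Types A B C : representation k K.

Lemma hom_space_mul A B C (f : 'M_(rdegree A, rdegree B))
    (g : 'M_(rdegree B, rdegree C)) :
  f \in hom_space A B -> g \in hom_space B C -> f *m g \in hom_space A C.
Proof.
move=> /hom_spaceP hf /hom_spaceP hg; apply/hom_spaceP => x Kx.
by rewrite mulmxA hf // -mulmxA hg // mulmxA.
Qed.

Lemma hom_space1 A : 1%:M \in hom_space A A.
Proof. by apply/hom_spaceP => g _; rewrite mulmx1 mul1mx. Qed.

Lemma hom_space_cancel A B C (f : 'M_(rdegree A, rdegree B))
    (g : 'M_(rdegree B, rdegree C)) :
    row_free g -> g \in hom_space B C -> f *m g \in hom_space A C ->
  f \in hom_space A B.
Proof.
move=> g_free /hom_spaceP hg /hom_spaceP hfg; apply/hom_spaceP => x Kx.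
by apply: (row_free_inj g_free); rewrite -mulmxA hfg // -!mulmxA hg.
Qed.

Lemma hom_space_kernel A B (f : 'M_(rdegree A, rdegree B)) :
    f \in hom_space A B ->
  {L : representation k K & {iota : 'M_(rdegree L, rdegree A) |
    [/\ iota \in hom_space L A, row_free iota & (iota :=: kermx f)%MS]}}.
Proof.
move=> /hom_spaceP hf; have modU : mxmodule A (kermx f).
  apply/mxmoduleP => g Kg; apply/sub_kermxP.
  by rewrite -mulmxA hf // mulmxA mulmx_ker mul0mx.
exists (Representation (submod_repr modU)), (val_submod 1%:M); split.
- apply/hom_spaceP => g Kg /=.
  by rewrite -val_submodE -[submod_mx _ g]mul1mx val_submodJ.
- by rewrite /row_free val_submod1.
- exact: val_submod1.
Qed.

(** The complement is the kernel of the splitting [v], onto which [1 - v u]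
  projects. *)
Lemma split_mono_summand A C (u : 'M_(rdegree A, rdegree C))
    (v : 'M_(rdegree C, rdegree A)) :
    u \in hom_space A C -> v \in hom_space C A -> u *m v = 1%:M ->
  exists A', mx_rsim C (dadd_grepr A A').
Proof.
move=> hu hv uv1; have [L [i [hi ifree ker_i]]] := hom_space_kernel hv.
pose w := (1%:M - v *m u) *m pinvmx i.
have wi : w *m i = 1%:M - v *m u.
  apply: mulmxKpV; rewrite ker_i; apply/sub_kermxP.
  by rewrite mulmxBl mul1mx -mulmxA uv1 mulmx1 subrr.
have iv : i *m v = 0 by apply/sub_kermxP; rewrite ker_i.
have inv1 : row_mx v w *m col_mx u i = 1%:M.
  by rewrite mul_row_col wi addrC subrK.
have inv2 : col_mx u i *m row_mx v w = 1%:M.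
  have uw : u *m w = 0.
    apply: (row_free_inj ifree); rewrite -mulmxA wi mulmxBr mulmx1 mulmxA uv1.
    by rewrite mul1mx subrr mul0mx.
  have iw : i *m w = 1%:M.
    apply: (row_free_inj ifree); rewrite -mulmxA wi mulmxBr mulmx1 mulmxA iv.
    by rewrite mul0mx subr0 mul1mx.
  by rewrite mul_col_row uv1 uw iv iw -scalar_mx_block.
exists L; apply: mx_rsim_sym; exists (col_mx u i).
- by apply/eqP; rewrite eqn_leq (mulmx1_min inv1) (mulmx1_min inv2).
- by apply/row_freeP; exists (row_mx v w).
move=> g Kg; move/hom_spaceP: hu => hu; move/hom_spaceP: hi => hi.
by rewrite /= mul_block_col !mul0mx addr0 add0r hu // hi // mul_col_mx.
Qed.

(** All maps to and from an iterated sum are assembled from these projections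
  and injections, so that its block structure never has to be opened again. *)
Lemma big_dadd_biproduct (I : eqType) (r : seq I)
    (X : I -> representation k K) (C := \big[@dadd_grepr k gT K/grepr0]_(i <- r) X i) :
    uniq r ->
  {p : forall i, 'M_(rdegree C, rdegree (X i)) &
  {e : forall i, 'M_(rdegree (X i), rdegree C) |
   [/\ forall i, p i \in hom_space C (X i), forall i, e i \in hom_space (X i) C,
       forall i, i \in r -> e i *m p i = 1%:M,
       forall i j, i != j -> e i *m p j = 0
     & \sum_(i <- r) p i *m e i = 1%:M]}}.
Proof.
rewrite {}/C; elim: r => [|a r IHr] /=.
  move=> _; rewrite !big_nil; exists (fun i => 0), (fun i => 0); split=> //.
  - by move=> i; rewrite mem0v.
  - by move=> i; rewrite mem0v.
  - by move=> i j _; rewrite mulmx0.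
  - by rewrite big_nil; apply/matrixP => -[].
case/andP=> a_r /IHr[p [e [hp he ep1 ep0 sum1]]]; rewrite big_cons.
set C := \big[_/_]_(i <- r) _ in p e hp he ep1 ep0 sum1 *.
(* For [i = a] the rectangular [pid_mx] is the identity matrix; it avoids a
   cast between [X i] and [X a]. *)
pose p' i : 'M_(rdegree (dadd_grepr (X a) C), rdegree (X i)) :=
  if i == a then col_mx (pid_mx (rdegree (X a))) 0 else col_mx 0 (p i).
pose e' i : 'M_(rdegree (X i), rdegree (dadd_grepr (X a) C)) :=
  if i == a then row_mx (pid_mx (rdegree (X a))) 0 else row_mx 0 (e i).
exists p', e'; rewrite /p' /e'; split=> [i | i | i | i j | ].
- apply/hom_spaceP => g Kg; case: eqVneq => [->|_] /=; rewrite mul_block_col mul_col_mx.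
    by rewrite pid_mx_1 !mulmx1 !mulmx0 mul0mx mul1mx !addr0.
  by move/hom_spaceP: (hp i) => hpi; rewrite !mulmx0 !mul0mx !add0r hpi.
- apply/hom_spaceP => g Kg; case: eqVneq => [->|_] /=; rewrite mul_row_block mul_mx_row.
    by rewrite pid_mx_1 !mulmx1 !mulmx0 !mul0mx mul1mx !addr0.
  by move/hom_spaceP: (he i) => hei; rewrite !mulmx0 !mul0mx !add0r hei.
- rewrite inE; case: eqVneq => [->|_ /= ir]; rewrite mul_row_col.
    by rewrite pid_mx_1 mulmx0 addr0 mulmx1.
  by rewrite mul0mx add0r ep1.
- case: (eqVneq i a) => [->|ia]; case: (eqVneq j a) => [->|ja];
    rewrite ?eqxx // => ij; rewrite mul_row_col ?mulmx0 ?mul0mx ?addr0 //.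
  by rewrite ep0 ?add0r.
rewrite big_cons eqxx; set S := \sum_(_ <- _) _.
have -> : S = \sum_(i <- r) block_mx 0 0 0 (p i *m e i).
  apply: eq_big_seq => i ir; have -> : (i == a) = false.
    by apply: contraNF a_r => /eqP <-.
  by rewrite mul_col_row !mul0mx mulmx0.
have -> : \sum_(i <- r) block_mx 0 0 0 (p i *m e i) =
          block_mx 0 0 0 1%:M :> 'M_(rdegree (X a) + rdegree C).
  rewrite -sum1; elim: (r) => [|b r' IH]; first by rewrite !big_nil block_mx0.
  by rewrite !big_cons IH add_block_mx !addr0.
rewrite mul_col_row pid_mx_1 !mul0mx !mulmx0 mul1mx add_block_mx !addr0 add0r.
by rewrite -scalar_mx_block.
Qed.

Lemma mx_rsim_iso_hom A B : mx_rsim A B ->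
  exists f : 'M_(rdegree A, rdegree B), exists g : 'M_(rdegree B, rdegree A),
    [/\ f \in hom_space A B, g \in hom_space B A, f *m g = 1%:M & g *m f = 1%:M].
Proof.
case/mx_rsim_def=> f [g gf1 homf]; have fg1 : f *m g = 1%:M.
  by have := homf _ (group1 K); rewrite !repr_mx1 mulmx1.
exists f, g; split=> //; apply/hom_spaceP => x Kx; rewrite homf // -mulmxA.
  by rewrite gf1 mulmx1.
by rewrite !mulmxA gf1 mul1mx.
Qed.

End HomSpaceTheory.

(** * Relative traces and induced modules *)

Section RelativeTrace.

Variables (k : fieldType) (gT : finGroupType).
Local Notation G := [set: gT]%G.
Local Notation kGmod := (representation k G).
Local Notation Hom H A B := (hom_space (res_repr H A) (res_repr H B)).
Implicit Types (H : {group gT}) (A B C M N : kGmod).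

Lemma hom_res H A B f : f \in hom_space A B -> f \in Hom H A B.
Proof.
by move/hom_spaceP => hf; apply/hom_spaceP => g _; apply: hf; rewrite inE.
Qed.

Lemma repr_mxMT A x y : A (x * y)%g = A x *m A y.
Proof. by rewrite repr_mxM ?inE. Qed.

Lemma hom_setT A B (f : 'M_(rdegree A, rdegree B)) g :
  f \in hom_space A B -> A g *m f = f *m B g.
Proof. by move/hom_spaceP => ->; rewrite ?inE. Qed.

(** For an [H]-homomorphism [f] each term depends on the coset of the
  representative alone, and the sum is a [G]-homomorphism. *)
Definition rel_trace H A B (f : 'M_(rdegree A, rdegree B)) :
    'M_(rdegree A, rdegree B) :=
  \sum_(i < #|rcosets H [set: gT]|)
    A (coset_rep i)^-1%g *m f *m B (coset_rep i).

Lemma rel_trace_comp H A B C D (f : 'M_(rdegree B, rdegree C))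
    (u : 'M_(rdegree A, rdegree B)) (v : 'M_(rdegree C, rdegree D)) :
    u \in hom_space A B -> v \in hom_space C D ->
  u *m rel_trace H f *m v = rel_trace H (A := A) (B := D) (u *m f *m v).
Proof.
move=> hu hv; rewrite /rel_trace mulmx_sumr mulmx_suml; apply: eq_bigr => i _.
by rewrite !mulmxA -(hom_setT _ hu) -!mulmxA (hom_setT _ hv).
Qed.

Section Induction.

Variables (H : {group gT}) (W : representation k H).
Local Notation m := #|rcosets H [set: gT]|.

Definition ind_counit M (f : 'M_(rdegree W, rdegree M)) :
    'M_(rdegree (ind_repr W), rdegree M) :=
  \mxcol_(i < m) (f *m M (coset_rep i)).

Definition ind_unit M (f : 'M_(rdegree M, rdegree W)) :
    'M_(rdegree M, rdegree (ind_repr W)) :=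
  \mxrow_(j < m) (M (coset_rep j)^-1%g *m f).

(** For each [x] a single coset representative [r] puts [x * r^-1] in [H], so
  the sum has one nonzero term. *)
Lemma ext0_sum_hom M (f : 'M_(rdegree W, rdegree M)) x :
    f \in hom_space W (res_repr H M) ->
  \sum_(l < m) ext0 W (x * (coset_rep l)^-1)%g *m (f *m M (coset_rep l)) =
  f *m M x.
Proof.
move=> /hom_spaceP hf; have [l Hl] := coset_rep_ex H x.
rewrite (bigD1 l) //= big1 ?addr0 => [|j ne_jl].
  by rewrite /ext0 Hl mulmxA hf //= -!mulmxA -repr_mxMT mulgKV.
rewrite /ext0; case: ifP => [Hj|]; last by rewrite mul0mx.
case/eqP: ne_jl; apply/eqP; rewrite -coset_rep_inj.
by rewrite -(groupMl _ Hj) !mulgA mulgKV.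
Qed.

Lemma ext0_sum x y :
  \sum_(l < m) ext0 W (x * (coset_rep l)^-1)%g *m ext0 W (coset_rep l * y)%g =
  ext0 W (x * y)%g.
Proof.
have [l Hl] := coset_rep_ex H x.
rewrite (bigD1 l) //= big1 ?addr0 => [|j ne_jl].
  have -> : (x * y = x * (coset_rep l)^-1 * (coset_rep l * y))%g.
    by rewrite !mulgA mulgKV.
  rewrite /ext0 Hl (groupMl _ Hl); case: ifP => Hy; last by rewrite mulmx0.
  by rewrite -repr_mxM.
rewrite /ext0; case: ifP => [Hj|]; last by rewrite mul0mx.
case/eqP: ne_jl; apply/eqP; rewrite -coset_rep_inj.
by rewrite -(groupMl _ Hj) !mulgA mulgKV.
Qed.

Lemma ind_counit_hom M (f : 'M_(rdegree W, rdegree M)) :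
  f \in hom_space W (res_repr H M) -> ind_counit f \in hom_space (ind_repr W) M.
Proof.
move=> hf; apply/hom_spaceP => g _ /=.
rewrite /ind_mx /ind_counit mul_mxblock_mxrow mxcol_mul; apply: eq_mxcol => i.
by rewrite ext0_sum_hom // -mulmxA -repr_mxMT.
Qed.

Lemma ind_unit_hom M (f : 'M_(rdegree M, rdegree W)) :
  f \in hom_space (res_repr H M) W -> ind_unit f \in hom_space M (ind_repr W).
Proof.
move=> /hom_spaceP hf; apply/hom_spaceP => g _ /=.
rewrite /ind_mx /ind_unit mul_mxrow_mxblock mul_mxrow; apply: eq_mxrow => j.
have [l Hl] := coset_rep_ex H (coset_rep j * g^-1)%g.
have {}Hl : (coset_rep l * g * (coset_rep j)^-1)%g \in H.
  by rewrite -groupV !invMg !invgK mulgA.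
rewrite (bigD1 l) //= big1 ?addr0 => [|i ne_il].
  rewrite /ext0 Hl -mulmxA -hf //= !mulmxA -!repr_mxMT; congr (M _ *m _).
  by rewrite !mulgA mulVg mul1g.
rewrite /ext0; case: ifP => [Hi|]; last by rewrite mulmx0.
case/eqP: ne_il; apply/eqP; rewrite -coset_rep_inj.
by rewrite -(groupMr _ Hl) !mulgA mulgKV.
Qed.

Lemma ind_unit_counit M N (f : 'M_(rdegree M, rdegree W))
    (f' : 'M_(rdegree W, rdegree N)) :
  ind_unit f *m ind_counit f' = rel_trace H (A := M) (B := N) (f *m f').
Proof.
by rewrite /ind_unit /ind_counit mul_mxrow_mxcol; apply: eq_bigr => i _;
  rewrite !mulmxA.
Qed.

(** The summand [W] of the restriction of the induced module, spanned by the
  [w (x) 1], and the projection onto it. *)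
Definition ind_incl : 'M_(rdegree W, rdegree (ind_repr W)) :=
  \mxrow_(j < m) ext0 W (coset_rep j)^-1%g.

Definition ind_proj : 'M_(rdegree (ind_repr W), rdegree W) :=
  \mxcol_(i < m) ext0 W (coset_rep i).

Lemma ind_inclM g :
  ind_incl *m ind_repr W g = \mxrow_(j < m) ext0 W (g * (coset_rep j)^-1)%g.
Proof.
rewrite /= /ind_mx /ind_incl mul_mxrow_mxblock; apply: eq_mxrow => j.
rewrite -[in RHS](mul1g (g * _)%g) -ext0_sum; apply: eq_bigr => i _.
by rewrite mul1g mulgA.
Qed.

Lemma ind_projM g :
  ind_repr W g *m ind_proj = \mxcol_(i < m) ext0 W (coset_rep i * g)%g.
Proof.
rewrite /= /ind_mx /ind_proj mul_mxblock_mxrow; apply: eq_mxcol => i.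
rewrite -[in RHS](mulg1 (_ * g)%g) -ext0_sum; apply: eq_bigr => j _.
by rewrite mulg1.
Qed.

Lemma ind_incl_hom : ind_incl \in hom_space W (res_repr H (ind_repr W)).
Proof.
apply/hom_spaceP => h Hh; rewrite [RHS]ind_inclM mul_mxrow.
apply: eq_mxrow => j; rewrite /ext0 (groupMl _ Hh).
by case: ifP => Hj; rewrite ?mulmx0 // -repr_mxM.
Qed.

Lemma ind_proj_hom : ind_proj \in hom_space (res_repr H (ind_repr W)) W.
Proof.
apply/hom_spaceP => h Hh; rewrite [LHS]ind_projM mxcol_mul.
apply: eq_mxcol => j; rewrite /ext0 (groupMr _ Hh).
by case: ifP => Hj; rewrite ?mul0mx // -repr_mxM.
Qed.

Lemma ind_incl_counit M (f : 'M_(rdegree W, rdegree M)) :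
  f \in hom_space W (res_repr H M) -> ind_incl *m ind_counit f = f.
Proof.
move=> hf; rewrite /ind_incl /ind_counit mul_mxrow_mxcol.
rewrite -[RHS]mulmx1 -(repr_mx1 M) -ext0_sum_hom //.
by apply: eq_bigr => i _; rewrite mul1g.
Qed.

(** The translates of the projection onto [w (x) 1] are the projections onto
  the blocks [w (x) r], which add up to the identity. *)
Lemma ind_trace :
  rel_trace H (A := ind_repr W) (B := ind_repr W) (ind_proj *m ind_incl) = 1%:M.
Proof.
rewrite -(repr_mx1 (ind_repr W)) /rel_trace.
under eq_bigr => l _ do
  rewrite mulmxA ind_projM -mulmxA ind_inclM mul_mxcol_mxrow.
rewrite -mxblock_sum; apply: eq_mxblock => i j.
rewrite ext0_sum; congr (ext0 W _).
by rewrite mulg1.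
Qed.

End Induction.

(** * Higman's criterion *)

Section Higman.

Variable chi : {set {group gT}}.

Definition rel_cover M : kGmod :=
  \big[@dadd_grepr k gT G/@grepr0 k gT G]_(H in chi) ind_repr (res_repr H M).

(** Higman's characterisation of relative projectivity.  Unlike the definition
  by direct summands it visibly passes to retracts. *)
Definition sum_of_traces M :=
  exists2 theta : {group gT} -> 'M_(rdegree M),
    forall H, H \in chi -> theta H \in Hom H M M
    & \sum_(H in chi) rel_trace H (A := M) (B := M) (theta H) = 1%:M.

Lemma rel_cover_biproduct M (X := fun H => ind_repr (res_repr H M)) :
  {p : forall H, 'M_(rdegree (rel_cover M), rdegree (X H)) &
  {e : forall H, 'M_(rdegree (X H), rdegree (rel_cover M)) |
   [/\ forall H, p H \in hom_space (rel_cover M) (X H),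
       forall H, e H \in hom_space (X H) (rel_cover M),
       forall H, H \in chi -> e H *m p H = 1%:M,
       forall H H', H != H' -> e H *m p H' = 0
     & \sum_(H in chi) p H *m e H = 1%:M]}}.
Proof.
have uniq_chi : uniq [seq H <- index_enum {group gT} | H \in chi].
  by rewrite filter_uniq // index_enum_uniq.
rewrite /rel_cover -big_filter.
have [p [e [hp he ep1 ep0 sum1]]] := big_dadd_biproduct X uniq_chi.
exists p, e; split=> // [H chiH|].
  by apply: ep1; rewrite mem_filter chiH mem_index_enum.
by apply: etrans sum1; apply/esym/big_filter.
Qed.

(** The sum of the counits splits over each [H] by [m |-> m (x) 1].  If the
  identity of [M] is a sum of traces of maps [theta H], then the units attached
  to the [theta H] split it over the whole group. *)
Lemma rel_cover_counit M :
  {eps : 'M_(rdegree (rel_cover M), rdegree M) |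
   [/\ eps \in hom_space (rel_cover M) M,
       forall H, H \in chi ->
         exists2 s, s \in Hom H M (rel_cover M) & s *m eps = 1%:M
     & sum_of_traces M ->
         exists2 s, s \in hom_space M (rel_cover M) & s *m eps = 1%:M]}.
Proof.
have [p [e [hp he ep1 ep0 sum1]]] := rel_cover_biproduct M.
pose c H := ind_counit (W := res_repr H M) (M := M) 1%:M.
have hom1 H : 1%:M \in Hom H M M by apply: hom_space1.
have hc H : c H \in hom_space (ind_repr (res_repr H M)) M.
  exact: ind_counit_hom.
pose eps := \sum_(H in chi) p H *m c H.
have e_eps H : H \in chi -> e H *m eps = c H.
  move=> chiH; rewrite mulmx_sumr (bigD1 H) //= mulmxA ep1 // mul1mx.
  rewrite -[RHS]addr0; congr (_ + _); apply: big1 => H' /andP[_ neH].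
  by rewrite mulmxA ep0 ?mul0mx // eq_sym.
exists eps; split=> [|H chiH|[theta htheta tr1]].
- by apply: memv_suml => H _; apply: hom_space_mul (hp H) (hc H).
- exists (ind_incl (res_repr H M) *m e H).
    exact: (hom_space_mul (B := res_repr H (ind_repr (res_repr H M)))
             (ind_incl_hom _) (hom_res H (he H))).
  by rewrite -mulmxA e_eps // ind_incl_counit.
exists (\sum_(H in chi) ind_unit (M := M) (W := res_repr H M) (theta H) *m e H).
  apply: memv_suml => H chiH.
  by apply: hom_space_mul (he H); apply: ind_unit_hom; apply: htheta.
rewrite mulmx_suml -tr1; apply: eq_bigr => H chiH.
by rewrite -mulmxA e_eps // ind_unit_counit mulmx1.
Qed.

Lemma sum_of_traces_retract A M (u : 'M_(rdegree M, rdegree A))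
    (v : 'M_(rdegree A, rdegree M)) :
    u \in hom_space M A -> v \in hom_space A M -> u *m v = 1%:M ->
  sum_of_traces A -> sum_of_traces M.
Proof.
move=> hu hv uv1 [theta htheta tr1]; exists (fun H => u *m theta H *m v).
  move=> H chiH; apply: hom_space_mul (hom_res H hv).
  exact: hom_space_mul (hom_res H hu) (htheta H chiH).
rewrite -uv1 -[u in RHS]mulmx1 -tr1 mulmx_sumr mulmx_suml.
by apply: eq_bigr => H _; rewrite rel_trace_comp.
Qed.

Lemma rel_cover_sum_of_traces M : sum_of_traces (rel_cover M).
Proof.
have [p [e [hp he ep1 ep0 sum1]]] := rel_cover_biproduct M.
pose th H : 'M_(rdegree (ind_repr (res_repr H M))) :=
  ind_proj (res_repr H M) *m ind_incl (res_repr H M).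
exists (fun H => p H *m th H *m e H) => [H _|].
  pose IH := res_repr H (ind_repr (res_repr H M)).
  apply: (hom_space_mul (B := IH) _ (hom_res H (he H))).
  apply: (hom_space_mul (B := IH) (hom_res H (hp H))).
  exact: (hom_space_mul (A := IH) (C := IH) (ind_proj_hom _) (ind_incl_hom _)).
rewrite -sum1; apply: eq_bigr => H _.
by rewrite -(rel_trace_comp H (th H) (hp H) (he H)) ind_trace mulmx1.
Qed.

Lemma rel_projective_sum_of_traces M : rel_projective chi M -> sum_of_traces M.
Proof.
case=> M' /mx_rsim_iso_hom[B [B' [hB hB' _ B'B]]].
have hi : row_mx 1%:M 0 \in hom_space M (dadd_grepr M M').
  apply/hom_spaceP => g _; rewrite /= mul_row_block mul_mx_row.
  by rewrite !mul0mx !mulmx0 mulmx1 mul1mx !addr0.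
have hp : col_mx 1%:M 0 \in hom_space (dadd_grepr M M') M.
  apply/hom_spaceP => g _; rewrite /= mul_block_col mul_col_mx.
  by rewrite !mul0mx !mulmx0 mulmx1 mul1mx !addr0.
apply: sum_of_traces_retract (hom_space_mul hi hB') (hom_space_mul hB hp) _
  (rel_cover_sum_of_traces M).
rewrite -mulmxA (mulmxA B') B'B mul1mx.
by rewrite mul_row_col mulmx1 mulmx0 addr0.
Qed.

Lemma sum_of_traces_rel_projective M : sum_of_traces M -> rel_projective chi M.
Proof.
move=> trM; have [eps [heps _ /(_ trM)[s hs s_eps]]] := rel_cover_counit M.
exact: split_mono_summand hs heps s_eps.
Qed.

End Higman.

End RelativeTrace.

(** * Existence of relative projective resolutions *)

Section Existence.

Variables (k : fieldType) (gT : finGroupType) (chi : {set {group gT}}).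
Local Notation G := [set: gT]%G.
Local Notation kGmod := (representation k G).
Local Notation Hom H A B := (hom_space (res_repr H A) (res_repr H B)).
Implicit Types (H : {group gT}) (M : kGmod).

Hypothesis chi_ne : chi != set0.

Definition cover_map M : 'M_(rdegree (rel_cover chi M), rdegree M) :=
  sval (rel_cover_counit chi M).

Lemma cover_map_hom M : cover_map M \in hom_space (rel_cover chi M) M.
Proof. by rewrite /cover_map; case: rel_cover_counit => eps []. Qed.

Lemma cover_map_split M H : H \in chi ->
  exists2 s, s \in Hom H M (rel_cover chi M) & s *m cover_map M = 1%:M.
Proof.
by rewrite /cover_map; case: rel_cover_counit => eps /= [_ /(_ H)].
Qed.

Lemma cover_map_full M : row_full (cover_map M).
Proof.
have [H chiH] := set0Pn _ chi_ne; have [s _ s1] := cover_map_split M chiH.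
by apply/row_fullP; exists s.
Qed.

Definition syzygy M : kGmod := projT1 (hom_space_kernel (cover_map_hom M)).

Definition syzygy_incl M : 'M_(rdegree (syzygy M), rdegree (rel_cover chi M)) :=
  sval (projT2 (hom_space_kernel (cover_map_hom M))).

Lemma syzygy_inclP M :
  [/\ syzygy_incl M \in hom_space (syzygy M) (rel_cover chi M),
      row_free (syzygy_incl M) & (syzygy_incl M :=: kermx (cover_map M))%MS].
Proof. exact: (svalP (projT2 (hom_space_kernel (cover_map_hom M)))). Qed.

(** Over [H] the inclusion of the syzygy has the retraction [1 - eps s], where
  [s] splits the counit [eps]. *)
Lemma syzygy_incl_split M H : H \in chi ->
  exists2 r, r \in Hom H (rel_cover chi M) (syzygy M)
           & syzygy_incl M *m r = 1%:M.
Proof.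
move=> chiH; have [s hs s1] := cover_map_split M chiH.
have [hi ifree ker_i] := syzygy_inclP M.
set i := syzygy_incl M in hi ifree ker_i *; set e := cover_map M in s1 ker_i.
pose r := (1%:M - e *m s) *m pinvmx i.
have ri : r *m i = 1%:M - e *m s.
  apply: mulmxKpV; rewrite ker_i; apply/sub_kermxP.
  by rewrite mulmxBl mul1mx -mulmxA s1 mulmx1 subrr.
have ie : i *m e = 0 by apply/sub_kermxP; rewrite ker_i.
exists r; last first.
  apply: (row_free_inj ifree); rewrite -mulmxA ri mulmxBr mulmx1 mulmxA ie.
  by rewrite mul0mx subr0 mul1mx.
apply: (hom_space_cancel (B := res_repr H (syzygy M))
          (C := res_repr H (rel_cover chi M)) ifree).
  exact (hom_res H hi).
rewrite ri; apply: memvB; first exact: hom_space1.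
exact: (hom_space_mul (B := res_repr H M) (hom_res H (cover_map_hom M)) hs).
Qed.

(** The resolution splices the covers of the iterated syzygies; each
  differential is a split surjection onto a syzygy followed by its split
  inclusion. *)
Lemma rel_resolution_exists : inhabited (rel_resolution k chi).
Proof.
pose K i := iter i syzygy (triv_repr k G).
pose Q i := rel_cover chi (K i).
pose d i : 'M_(rdegree (Q i.+1), rdegree (Q i)) :=
  cover_map (K i.+1) *m syzygy_incl (K i).
have Qproj i : rel_projective chi (Q i).
  exact: sum_of_traces_rel_projective (rel_cover_sum_of_traces _ _).
have d_hom i : d i \in hom_space (Q i.+1) (Q i).
  by have [hi _ _] := syzygy_inclP (K i); apply: hom_space_mul hi;
     apply: cover_map_hom.
have im_d i : (d i :=: kermx (cover_map (K i)))%MS.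
  have [_ _ ker_i] := syzygy_inclP (K i); apply: eqmx_trans ker_i.
  exact: eqmxMfull (cover_map_full _).
have d_exact i : (d i.+1 :=: kermx (d i))%MS.
  apply: eqmx_trans (im_d _) _; apply/eqmxP; have [_ ifree _] := syzygy_inclP (K i).
  apply/andP; split; apply/sub_kermxP; last first.
    by apply: (row_free_inj ifree); rewrite mul0mx -mulmxA mulmx_ker.
  by rewrite mulmxA mulmx_ker mul0mx.
have d_split H i : H \in chi -> Defs.splits_over H (d i).
  move=> chiH; have [r hr ir1] := syzygy_incl_split (K i) chiH.
  have [s hs s1] := cover_map_split (K i.+1) chiH.
  exists (r *m s).
    exact: (hom_space_mul (B := res_repr H (K i.+1)) hr hs).
  by rewrite /d -!mulmxA (mulmxA s) s1 mul1mx (mulmxA (syzygy_incl _)) ir1 mul1mx.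
have aug_split H : H \in chi -> Defs.splits_over H (cover_map (K 0)).
  move=> chiH; have [s hs s1] := cover_map_split (K 0) chiH.
  by exists s => //; rewrite -mulmxA s1 mulmx1.
constructor; exact: (RelResolution Qproj d_hom (cover_map_hom (K 0)) d_exact
  (im_d 0) (cover_map_full (K 0)) d_split aug_split).
Qed.

End Existence.

(** * The Klein four-group *)

Section KleinGroup.

Variables (gT : finGroupType).
Implicit Types x y z w : gT.

Lemma klein4_sym x y : klein4 x y -> klein4 y x.
Proof. by case=> abG oG genG; split=> //; rewrite setUC. Qed.

Lemma klein4_shear x y : klein4 x y -> klein4 (x * y)%g y.
Proof.
case=> abG oG genG; split=> //; apply/eqP; rewrite eqEsubset subsetT /= -genG.
rewrite gen_subG; apply/subsetP => z; rewrite !inE.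
have Ey : y \in <<[set (x * y)%g; y]>>%g by rewrite mem_gen // !inE eqxx orbT.
case/orP=> /eqP -> //; rewrite -(groupMr _ Ey).
by rewrite mem_gen // !inE eqxx.
Qed.

Lemma klein4_chi_sym x y : klein4 x y -> klein4_chi y x = klein4_chi x y.
Proof.
move=> /klein4_enum[_ _ _ _ yx]; rewrite /klein4_chi yx.
by rewrite [[set <[y]>%G; _]]setUC.
Qed.

Lemma klein4_chi_shear x y :
  klein4 x y -> klein4_chi (x * y)%g y = klein4_chi x y.
Proof.
move=> /klein4_enum[_ _ _ yy _]; rewrite /klein4_chi -mulgA yy mulg1.
by apply/setP => H; rewrite !inE; do 2!case: (H == _); rewrite ?orbT ?orbF.
Qed.

Lemma klein4_cycle x y : klein4 x y -> <[x]>%g = [set 1%g; x].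
Proof.
move=> /klein4_enum[_ /= /andP[]]; rewrite !inE !negb_or => /andP[x1 _] _ xx _ _.
by apply: cycle2g; apply: nt_prime_order; rewrite // eq_sym.
Qed.

Variables (k : fieldType).
Local Notation G := [set: gT]%G.
Local Notation kGmod := (representation k G).
Local Notation Hom H A B := (hom_space (res_repr H A) (res_repr H B)).
Implicit Types (A B M N : kGmod).

Lemma hom_cycleP x A B (f : 'M_(rdegree A, rdegree B)) :
  reflect (A x *m f = f *m B x) (f \in Hom <[x]>%G A B).
Proof.
apply: (iffP idP) => [/hom_spaceP hf | hf]; first exact: hf (cycle_id x).
apply/hom_spaceP => _ /cycleP[i ->] /=; elim: i => [|i IHi].
  by rewrite expg0 !repr_mx1 mulmx1 mul1mx.
by rewrite expgS !repr_mxMT -mulmxA IHi mulmxA hf mulmxA.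
Qed.

Lemma klein4_homP x y A B (f : 'M_(rdegree A, rdegree B)) : klein4 x y ->
  reflect (A x *m f = f *m B x /\ A y *m f = f *m B y) (f \in hom_space A B).
Proof.
move=> /klein4_enum[cov _ _ _ _]; apply: (iffP idP) => [hf | [hx hy]].
  by rewrite !(hom_setT _ hf).
apply/hom_spaceP => g _; have /or4P[] := cov g; move=> /eqP-> //.
  by rewrite !repr_mx1 mulmx1 mul1mx.
by rewrite !repr_mxMT -mulmxA hy mulmxA hx mulmxA.
Qed.

(** [1] and [y] represent the two cosets of [<[x]>]. *)
Lemma klein4_rel_trace x y A B (f : 'M_(rdegree A, rdegree B)) :
    klein4 x y -> f \in Hom <[x]>%G A B ->
  rel_trace <[x]>%G f = f + A y *m f *m B y.
Proof.
move=> Gxy hf; have [cov] := klein4_enum Gxy.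
rewrite /= !inE !negb_or !andbT.
move=> /and3P[/and3P[n1x n1y _] /andP[nxy _] _] xx yy yx.
have def_x := klein4_cycle Gxy.
pose F (g : gT) := A g^-1%g *m f *m B g.
have FH h g : h \in <[x]>%g -> F (h * g)%g = F g.
  move=> Hh; rewrite /F invMg !repr_mxMT.
  move/hom_spaceP: hf => /(_ h Hh) /= hfh.
  rewrite mulmxA -(mulmxA _ f) -hfh !mulmxA -(mulmxA (A g^-1%g)) -repr_mxMT.
  by rewrite mulVg repr_mx1 mulmx1.
have -> : rel_trace <[x]>%G f = \sum_(C in rcosets <[x]> [set: gT]) F (repr C).
  by rewrite big_enum_val.
have -> : rcosets <[x]> [set: gT] = [set <[x]>%g; <[x]> :* y]%g.
  apply/eqP; rewrite eqEsubset; apply/andP; split; apply/subsetP => C.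
    case/rcosetsP => g _ ->; rewrite !inE.
    have /or4P[] := cov g; move=> /eqP->.
    - by rewrite rcoset1 eqxx.
    - by rewrite rcoset_id ?cycle_id ?eqxx.
    - by rewrite eqxx orbT.
    - by rewrite rcosetM rcoset_id ?cycle_id ?eqxx ?orbT.
  rewrite !inE => /orP[] /eqP->; apply/rcosetsP.
    by exists 1%g; rewrite ?inE // rcoset1.
  by exists y; rewrite ?inE.
rewrite big_setU1 ?big_set1 /=; last first.
  rewrite inE eq_sym; apply/eqP => /esym E.
  have : y \in <[x]>%g by rewrite E rcoset_refl.
  by rewrite def_x !inE ![y == _]eq_sym (negPf n1y) (negPf nxy).
have F1 : F 1%g = f by rewrite /F invg1 !repr_mx1 mulmx1 mul1mx.
have Fy : F y = A y *m f *m B y.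
  by rewrite /F (_ : y^-1 = y)%g //; apply/eqP; rewrite eq_invg_mul yy.
rewrite -Fy -F1; congr (_ + _).
  by rewrite repr_group.
have /rcosetP[h Hh ->] : repr (<[x]> :* y)%g \in (<[x]> :* y)%g.
  exact: mem_repr_rcoset.
exact: FH.
Qed.

End KleinGroup.

(** * Cohomology by transfer from a subgroup of order two *)

Section DegreeZero.

Variables (k : fieldType) (gT : finGroupType) (K : {group gT}).
Variables (Q N : representation k K) (m : nat) (d : 'M[k]_(m, rdegree Q)).
Variable (aug : 'M[k]_(rdegree Q, 1)).

(** The homomorphisms [Q -> N] vanishing on the kernel of the augmentation are
  those that factor through it.  It is stated for an arbitrary subgroup because
  it is used both for the whole group and for the subgroup of order two. *)
Lemma dim_cocycles0 :
    aug \in hom_space Q (triv_repr k K) -> row_full aug ->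
    (d :=: kermx aug)%MS ->
  \dim (hom_space Q N :&: lker (linfun (mulmx d)) : {vspace 'M_(_, rdegree N)}) =
  \dim (hom_space (triv_repr k K) N).
Proof.
move=> /hom_spaceP haug /row_fullP[p paug] ker_d.
pose L : 'Hom('M[k]_(1, rdegree N), 'M[k]_(rdegree Q, rdegree N)) :=
  linfun (mulmx aug).
have L_inj : lker L == 0%VS.
  apply/lker0P => u v; rewrite !lfunE /= => /(congr1 (mulmx p)).
  by rewrite !mulmxA paug !mul1mx.
have [w def_w] : exists w, 1%:M - aug *m p = w *m d.
  apply/submxP; rewrite ker_d; apply/sub_kermxP.
  by rewrite mulmxBl mul1mx -mulmxA paug mulmx1 subrr.
rewrite -[RHS](limg_dim_eq (f := L)); last first.
  by rewrite (eqP L_inj) capv0.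
congr (\dim _); apply/eqP; rewrite eqEsubv; apply/andP; split; apply/subvP => f.
  rewrite memv_cap memv_ker lfunE => /andP[/hom_spaceP hf /eqP /= df].
  have def_f : f = aug *m (p *m f).
    apply/eqP; rewrite -subr_eq0 mulmxA -[X in X - _]mul1mx -mulmxBl def_w.
    by rewrite -mulmxA df mulmx0.
  apply/memv_imgP; exists (p *m f); last by rewrite lfunE.
  apply/(@hom_spaceP _ _ _ (triv_repr k K)) => g Kg.
  rewrite mul1mx -mulmxA -hf // [X in Q g *m X]def_f (mulmxA (Q g)) haug //.
  by rewrite mulmx1 [RHS]mulmxA paug mul1mx.
case/memv_imgP => v /(@hom_spaceP _ _ _ (triv_repr k K)) hv ->.
rewrite memv_cap memv_ker !lfunE /=.
apply/andP; split.
  by apply/hom_spaceP => g Kg; rewrite mulmxA haug // mulmx1 -mulmxA -hv ?mul1mx.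
have d_aug : d *m aug = 0 by apply/sub_kermxP; rewrite ker_d.
by rewrite mulmxA d_aug mul0mx.
Qed.

End DegreeZero.

Section Counting.

Variables (gT : finGroupType) (x y : gT) (Gxy : klein4 x y).
Variables (k : fieldType) (k2 : 2%N \in [pchar k]).
Local Notation G := [set: gT]%G.
Local Notation kGmod := (representation k G).
Local Notation Hom H A B := (hom_space (res_repr H A) (res_repr H B)).
Local Notation chi := (klein4_chi x y).
Variable N : kGmod.

(** For [z] of order two this says that [N] is free over [<[z]>]: its identity
  is a trace from the trivial group. *)
Definition trace_split z :=
  exists psi : 'M[k]_(rdegree N), psi + N z *m psi *m N z = 1%:M.

Hypotheses (free_y : trace_split y) (free_xy : trace_split (x * y)%g).

Lemma addmx_pchar2 m n (A : 'M[k]_(m, n)) : A + A = 0.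
Proof. by rewrite -[A]scale1r -scalerDl -mulr2n (pcharf0 k2) scale0r. Qed.

(** The relative trace from [<[x]>], with [1] and [y] as coset representatives,
  extended to a linear map on all matrices. *)
Definition transfer (A : kGmod) : 'End('M[k]_(rdegree A, rdegree N)) :=
  linfun (idfun \+ (mulmx (A y) \o mulmxr (N y))).

Lemma transferE A f : transfer A f = f + A y *m f *m N y.
Proof. by rewrite lfunE /= mulmxA. Qed.

Lemma transfer_mul A B (u : 'M_(rdegree A, rdegree B)) f :
  u \in hom_space A B -> transfer A (u *m f) = u *m transfer B f.
Proof.
by move=> hu; rewrite !transferE mulmxDr !mulmxA (hom_setT _ hu).
Qed.

(** In characteristic 2 and with [y] an involution, [f + y f y = 0] says that
  [f] commutes with [y]. *)
Lemma transfer_ker A :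
  (Hom <[x]>%G A N :&: lker (transfer A) = hom_space A N)%VS.
Proof.
have [_ _ xx yy _] := klein4_enum Gxy.
have Ayy (B : kGmod) : B y *m B y = 1%:M by rewrite -repr_mxMT yy repr_mx1.
apply/vspaceP => f; rewrite memv_cap memv_ker transferE.
apply/andP/(klein4_homP _ Gxy) => [[/hom_cycleP hx /eqP fy0] | [hx hy]]; split.
- exact: hx.
- have := congr1 (fun u => A y *m u) fy0.
  rewrite mulmxDr mulmx0 !mulmxA Ayy mul1mx => /(canRL (addrK _)) ->.
  by rewrite add0r -[LHS]addr0 -(addmx_pchar2 (f *m N y)) addKr.
- exact/hom_cycleP.
- by rewrite hy -mulmxA Ayy mulmx1 addmx_pchar2.
Qed.

Lemma transfer_hom A f :
  f \in Hom <[x]>%G A N -> transfer A f \in hom_space A N.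
Proof.
have [_ _ xx yy yx] := klein4_enum Gxy.
move=> /hom_cycleP hx; apply/(klein4_homP _ Gxy); rewrite transferE; split.
  rewrite mulmxDr mulmxDl hx; congr (_ + _).
  rewrite !mulmxA -repr_mxMT -yx repr_mxMT -!(mulmxA (A y)) -!mulmxA; congr (_ *m _).
  by rewrite mulmxA hx -!mulmxA -!repr_mxMT yx.
rewrite mulmxDr mulmxDl !mulmxA -repr_mxMT yy repr_mx1 mul1mx.
by rewrite -!mulmxA -(repr_mxMT N y y) yy repr_mx1 mulmx1 addrC.
Qed.

(** For [H] other than [<[x]>], [N] is free over [H], so that [f] is the trace
  from the trivial group to [H] of some [h].  Then the trace of [f] is the sum
  of all [g^-1 h g], which is the transfer of [h + x h x]. *)
Lemma rel_trace_transfer A H (f : 'M_(rdegree A, rdegree N)) :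
    H \in chi -> f \in Hom H A N ->
  rel_trace H f \in (transfer A @: Hom <[x]>%G A N)%VS.
Proof.
have [_ _ xx yy yx] := klein4_enum Gxy.
rewrite !inE -orbA => /or3P[] /eqP-> hf.
- by rewrite (klein4_rel_trace Gxy hf) -transferE memv_img.
- have [psi psi1] := free_y; rewrite (klein4_rel_trace (klein4_sym Gxy) hf).
  pose h := f *m psi; have -> : f = h + A y *m h *m N y.
    move/hom_cycleP: hf => hy; rewrite /h mulmxA hy -[LHS]mulmx1 -psi1.
    by rewrite mulmxDr !mulmxA.
  have -> : h + A y *m h *m N y + A x *m (h + A y *m h *m N y) *m N x =
            transfer A (h + A x *m h *m N x).
    rewrite transferE !mulmxDr !mulmxDl !mulmxA -!repr_mxMT yx.
    by rewrite -!mulmxA -!repr_mxMT yx -!addrA (addrCA (A y *m _)).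
  apply: memv_img; apply/hom_cycleP.
  rewrite mulmxDr mulmxDl !mulmxA -repr_mxMT xx repr_mx1 mul1mx.
  by rewrite -!mulmxA -(repr_mxMT N x x) xx repr_mx1 mulmx1 addrC.
have [psi psi1] := free_xy; rewrite (klein4_rel_trace (klein4_shear Gxy) hf).
pose h := f *m psi; have -> : f = h + A (x * y)%g *m h *m N (x * y)%g.
  move/hom_cycleP: hf => hy; rewrite /h mulmxA hy -[LHS]mulmx1 -psi1.
  by rewrite mulmxDr !mulmxA.
have yxy : (y * (x * y) = x)%g by rewrite mulgA yx -mulgA yy mulg1.
have xyy : (x * y * y = x)%g by rewrite -mulgA yy mulg1.
set u := (x * y)%g in yxy xyy *.
have -> : h + A u *m h *m N u + A y *m (h + A u *m h *m N u) *m N y =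
          transfer A (h + A x *m h *m N x).
  rewrite transferE !mulmxDr !mulmxDl !mulmxA -!repr_mxMT yxy yx.
  rewrite -!mulmxA -!repr_mxMT xyy -/u -!addrA; congr (_ + _).
  by rewrite addrCA [in RHS]addrCA; congr (_ + _); rewrite addrC.
apply: memv_img; apply/hom_cycleP.
rewrite mulmxDr mulmxDl !mulmxA -repr_mxMT xx repr_mx1 mul1mx.
by rewrite -!mulmxA -(repr_mxMT N x x) xx repr_mx1 mulmx1 addrC.
Qed.

Lemma transfer_onto A : rel_projective chi A ->
  (transfer A @: Hom <[x]>%G A N = hom_space A N)%VS.
Proof.
move=> /rel_projective_sum_of_traces[theta htheta tr1].
apply/eqP; rewrite eqEsubv; apply/andP; split; apply/subvP => f.
  by case/memv_imgP => u hu ->; apply: transfer_hom.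
move=> hf; rewrite -[f]mul1mx -tr1 mulmx_suml; apply: memv_suml => H chiH.
have := rel_trace_comp H (theta H) (hom_space1 A) hf.
rewrite !mul1mx => ->; apply: rel_trace_transfer => //.
exact: (hom_space_mul (B := res_repr H A) (htheta H chiH) (hom_res H hf)).
Qed.

Section Resolution.

Variable Q : rel_resolution k chi.

Local Notation HQ i := (Hom <[x]>%G (Q i) N).
Local Notation GQ i := (hom_space (Q i) N).
Local Notation d i := (cobound Q N i).

Lemma chi_x : <[x]>%G \in chi.
Proof. by rewrite !inE eqxx. Qed.

Lemma coboundE i f : d i f = rres_d Q i *m f.
Proof. by rewrite lfunE. Qed.

Lemma cobound_cobound i f : d i.+1 (d i f) = 0.
Proof.
have dd : rres_d Q i.+1 *m rres_d Q i = 0.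
  by apply/sub_kermxP; rewrite (rres_d_exact Q i).
by rewrite !coboundE mulmxA dd mul0mx.
Qed.

(** A splitting of the differential over [<[x]>] is a contracting homotopy. *)
Lemma cocycles_res i : (HQ i.+1 :&: lker (d i.+1) = d i @: HQ i)%VS.
Proof.
have hd := hom_res <[x]>%G (rres_d_hom Q i).
apply/eqP; rewrite eqEsubv; apply/andP; split; apply/subvP => f; last first.
  case/memv_imgP => u hu ->; rewrite memv_cap memv_ker cobound_cobound eqxx andbT.
  by rewrite coboundE; exact: (hom_space_mul hd (C := res_repr <[x]>%G N) hu).
rewrite memv_cap memv_ker coboundE => /andP[hf /eqP df].
have [s hs dsd] := rres_d_split Q i chi_x.
apply/memv_imgP; exists (s *m f).
  exact: (hom_space_mul (B := res_repr <[x]>%G (Q i.+1)) hs hf).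
have [w def_w] : exists w, 1%:M - rres_d Q i *m s = w *m rres_d Q i.+1.
  apply/submxP; rewrite (rres_d_exact Q i); apply/sub_kermxP.
  by rewrite mulmxBl mul1mx dsd subrr.
apply/eqP; rewrite coboundE -subr_eq0 mulmxA -[X in X - _]mul1mx -mulmxBl def_w.
by rewrite -mulmxA df mulmx0.
Qed.

Lemma coboundaries_sub i : (coboundaries Q N i <= cocycles Q N i)%VS.
Proof.
case: i => [|i] /=; first exact: sub0v.
apply/subvP => f /memv_imgP[u hu ->].
rewrite memv_cap memv_ker cobound_cobound eqxx andbT coboundE.
exact: hom_space_mul (rres_d_hom Q i) hu.
Qed.

Lemma dim_cohomology i :
  (\dim (cohomology Q N i) + \dim (coboundaries Q N i))%N = \dim (cocycles Q N i).
Proof.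
rewrite /cohomology -[RHS](dimv_cap_compl _ (coboundaries Q N i)) addnC.
by rewrite (capv_idPr (coboundaries_sub i)).
Qed.

(** Over [<[x]>] the cocycles are the coboundaries, and the transfer maps those
  onto the coboundaries over [G], since it is onto in each degree and commutes
  with the differential.  Its kernel on them consists of the cocycles over
  [G]. *)
Lemma dim_cocycles_res i :
  \dim (HQ i.+1 :&: lker (d i.+1)) =
  (\dim (cocycles Q N i.+1) + \dim (coboundaries Q N i.+1))%N.
Proof.
rewrite -(limg_ker_dim (transfer (Q i.+1))).
have -> : (HQ i.+1 :&: lker (d i.+1) :&: lker (transfer (Q i.+1)) =
           cocycles Q N i.+1)%VS.
  by rewrite -capvA [(lker (d _) :&: _)%VS]capvC capvA transfer_ker.
have -> // : (transfer (Q i.+1) @: (HQ i.+1 :&: lker (d i.+1)) =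
              coboundaries Q N i.+1)%VS.
rewrite cocycles_res /= -(transfer_onto (rres_proj Q i)) -!limg_comp.
congr (_ @: _)%VS; apply/lfunP => f; rewrite !comp_lfunE /=.
by rewrite !coboundE transfer_mul // rres_d_hom.
Qed.

Lemma dim_hom_res i : \dim (HQ i) = (\dim (GQ i) + \dim (GQ i))%N.
Proof.
rewrite -(limg_ker_dim (transfer (Q i))) transfer_ker.
by rewrite (transfer_onto (rres_proj Q i)).
Qed.

Lemma dim_hom_resS i :
  \dim (HQ i) =
  (\dim (HQ i :&: lker (d i)) + \dim (HQ i.+1 :&: lker (d i.+1)))%N.
Proof. by rewrite -(limg_ker_dim (d i)) cocycles_res. Qed.

Lemma dim_homS i :
  \dim (GQ i) = (\dim (cocycles Q N i) + \dim (coboundaries Q N i.+1))%N.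
Proof. by rewrite -(limg_ker_dim (d i)). Qed.

Lemma dim_cocycles_0 :
  \dim (cocycles Q N 0) = \dim (hom_space (triv_repr k G) N).
Proof.
exact: dim_cocycles0 (rres_aug_hom Q) (rres_aug_onto Q) (rres_aug_exact Q).
Qed.

Lemma dim_cocycles_res_0 :
  \dim (HQ 0 :&: lker (d 0)) =
  \dim (hom_space (triv_repr k <[x]>%G) (res_repr <[x]>%G N)).
Proof.
exact: (dim_cocycles0 (res_repr <[x]>%G N) (hom_res <[x]>%G (rres_aug_hom Q))
          (rres_aug_onto Q) (rres_aug_exact Q)).
Qed.

(** Let [g], [z], [b] be the dimensions of the cochains, cocycles and
  coboundaries over [G].  In degree [i > 0] exactness over [<[x]>] reads
  [2 g_i = (z_i + b_i) + (z_(i+1) + b_(i+1))]; with [g_i = z_i + b_(i+1)] this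
  gives [z_(i+1) - b_(i+1) = z_i - b_i].  In degree [0] the term [z_0 + b_0] is
  replaced by the dimension of the [<[x]>]-fixed space. *)
Lemma dim_cohomology_S i :
  (\dim (cohomology Q N i.+1) +
     \dim (hom_space (triv_repr k <[x]>%G) (res_repr <[x]>%G N)))%N =
  (\dim (hom_space (triv_repr k G) N)).*2.
Proof.
rewrite -dim_cocycles_0 -dim_cocycles_res_0; elim: i => [|i IHi].
  have := dim_hom_resS 0; rewrite dim_hom_res dim_homS dim_cocycles_res.
  have := dim_cohomology 1.
  move: (\dim (cohomology Q N 1)) (\dim (cocycles Q N 1)) => h1 z1.
  move: (\dim (coboundaries Q N 1)) (\dim (cocycles Q N 0)) => b1 z0.
  by move: (\dim _) => zH0; rewrite -addnn; lia.
rewrite -IHi; congr (_ + _)%N; have := dim_hom_resS i.+1.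
rewrite dim_hom_res dim_homS !dim_cocycles_res.
move: (dim_cohomology i.+1) (dim_cohomology i.+2).
move: (\dim (cohomology Q N i.+1)) (\dim (cohomology Q N i.+2)) => h1 h2.
move: (\dim (cocycles Q N i.+1)) (\dim (cocycles Q N i.+2)) => z1 z2.
move: (\dim (coboundaries Q N i.+1)) (\dim (coboundaries Q N i.+2)) => b1 b2.
by lia.
Qed.

End Resolution.
End Counting.

(** * Modules of two-step form *)

Section Transport.

Variables (k : fieldType) (gT : finGroupType) (K : {group gT}).

Lemma dim_hom_rsim (A N V : representation k K) : mx_rsim N V ->
  \dim (hom_space A N) = \dim (hom_space A V).
Proof.
have le_dim (M1 M2 : representation k K) : mx_rsim M1 M2 ->
    (\dim (hom_space A M1) <= \dim (hom_space A M2))%N.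
  case/mx_rsim_iso_hom=> f [g [hf _ fg1 _]].
  pose L : 'Hom('M[k]_(rdegree A, rdegree M1), 'M[k]_(rdegree A, rdegree M2)) :=
    linfun (mulmxr f).
  have L_inj : lker L == 0%VS.
    apply/lker0P => u v; rewrite !lfunE /= => /(congr1 (mulmxr g)) /=.
    by rewrite -!mulmxA fg1 !mulmx1.
  rewrite -(limg_dim_eq (f := L)); last by rewrite (eqP L_inj) capv0.
  apply: dimvS; apply/subvP => _ /memv_imgP[u hu ->]; rewrite lfunE /=.
  exact: hom_space_mul hu hf.
by move=> NV; apply/eqP; rewrite eqn_leq !le_dim //; apply: mx_rsim_sym.
Qed.

Lemma dim_lker_mulmxr m n (M : 'M[k]_(m, n)) :
  (\dim (lker (linfun (mulmxr M) : 'Hom('rV[k]_m, 'rV[k]_n))) + \rank M)%N = m.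
Proof.
pose f (p : nat) (M : 'M[k]_(p, n)) : 'Hom('rV[k]_p, 'rV[k]_n) :=
  linfun (mulmxr M).
have -> : \rank M = \dim (limg (f _ M)).
  have -> : limg (f _ M) = limg (f _ (row_base M)).
    apply/vspaceP => v; apply/memv_imgP/memv_imgP => -[u _ ->].
      rewrite lfunE /=; have /submxP[w ->] : (u *m M <= row_base M)%MS.
        by rewrite eq_row_base submxMl.
      by exists w; rewrite ?memvf // lfunE.
    rewrite lfunE /=; have /submxP[w ->] : (u *m row_base M <= M)%MS.
      by rewrite -(eq_row_base M) submxMl.
    by exists w; rewrite ?memvf // lfunE.
  rewrite limg_dim_eq; first by rewrite dimvf dim_matrix; apply/esym/mul1n.
  rewrite capfv; apply/eqP/lker0P => u v; rewrite !lfunE /=.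
  exact/row_free_inj/row_base_free.
rewrite -[lker _]capfv limg_ker_dim dimvf dim_matrix; exact: mul1n.
Qed.

End Transport.

Section TwoStepCohomology.

Variables (gT : finGroupType) (k : fieldType) (k2 : 2%N \in [pchar k]).
Local Notation G := [set: gT]%G.
Local Notation kGmod := (representation k G).

Lemma trace_split_rsim (N V : kGmod) z :
  mx_rsim N V -> trace_split V z -> trace_split N z.
Proof.
case/mx_rsim_iso_hom=> f [g [hf hg fg1 gf1]] [psi psi1].
exists (f *m psi *m g); rewrite -[RHS]fg1 -[f in RHS]mulmx1 -psi1.
rewrite mulmxDr mulmxDl !mulmxA (hom_setT z hf) -!mulmxA.
by rewrite -(hom_setT z hg) !mulmxA.
Qed.

Definition unip n (D : 'M[k]_n) : 'M[k]_(n + n) := block_mx 1%:M D 0 1%:M.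

Lemma unip_mul n (D E : 'M[k]_n) : unip D *m unip E = unip (D + E).
Proof.
by rewrite /unip mulmx_block !mulmx0 !mul0mx !mul1mx !mulmx1 !addr0 add0r addrC.
Qed.

(** The rows [(a, 0)] form a basis over the group of order two, and the witness
  is the projection to the coefficient of [1] in it. *)
Lemma unip_trace_split n (D : 'M[k]_n) : D \in unitmx ->
  exists psi, psi + unip D *m psi *m unip D = 1%:M.
Proof.
move=> uD; exists (block_mx 1%:M 0 (invmx D) 0).
rewrite /unip !mulmx_block !mulmx0 !mul0mx !mul1mx !mulmx1 !addr0 !add0r.
rewrite mulmxV // mulVmx // !(addmx_pchar2 k2) mul0mx add_block_mx.
rewrite !(addmx_pchar2 k2) addr0 add0r.
by rewrite -scalar_mx_block.
Qed.

Lemma rank_unip n (D : 'M[k]_n) : \rank (unip D - 1%:M) = \rank D.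
Proof.
rewrite /unip scalar_mx_block opp_block_mx add_block_mx !subrr !subr0.
by rewrite /block_mx row_mx0 rank_col_mx0 rank_row_0mx.
Qed.

Variables (s t : gT) (Gst : klein4 s t) (n : nat) (A B : 'M[k]_n).
Local Notation V := (two_step_repr Gst k2 A B).

Lemma two_step_sE : V s = unip A.
Proof.
apply: (addIr (- 1%:M)); rewrite [LHS](two_step_s Gst) /unip.
by rewrite scalar_mx_block opp_block_mx add_block_mx !subrr !subr0.
Qed.

Lemma two_step_tE : V t = unip B.
Proof.
apply: (addIr (- 1%:M)); rewrite [LHS](two_step_t Gst) /unip.
by rewrite scalar_mx_block opp_block_mx add_block_mx !subrr !subr0.
Qed.

Variables (x y : gT) (Gxy : klein4 x y) (D E : 'M[k]_n).
Hypotheses (Vx : V x = unip D) (Vy : V y = unip E).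

Lemma hom_triv_cycleP z (v : 'rV_(n + n)) :
  reflect (v *m V z = v)
          (v \in hom_space (triv_repr k <[z]>%G) (res_repr <[z]>%G V)).
Proof.
apply: (iffP (@hom_cycleP gT k z (triv_repr k G) V v)) => /=.
  by rewrite mul1mx => <-.
by rewrite mul1mx.
Qed.

Lemma dim_fixed_cycle z (F : 'M[k]_n) : V z = unip F ->
  (\dim (hom_space (triv_repr k <[z]>%G) (res_repr <[z]>%G V)) + \rank F)%N =
  (n + n)%N.
Proof.
move=> Vz; rewrite -rank_unip -[RHS](dim_lker_mulmxr (unip F - 1%:M)).
congr (\dim _ + _)%N; apply/vspaceP => v; rewrite memv_ker lfunE /=.
rewrite mulmxBr mulmx1 subr_eq0 -Vz; exact: (sameP (hom_triv_cycleP z v) eqP).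
Qed.

(** As [E] is invertible, a row fixed by [y] has the form [(0, b)], and such rows
  are fixed by the whole group. *)
Lemma dim_fixed : E \in unitmx -> \dim (hom_space (triv_repr k G) V) = n.
Proof.
move=> uE; have := dim_fixed_cycle Vy; rewrite (mxrank_unit uE) => /addIn.
apply: etrans; congr (\dim _); apply/vspaceP => v.
apply/idP/idP => [hv | /hom_triv_cycleP hv].
  apply/hom_triv_cycleP; have := hom_setT (A := triv_repr k G) (B := V) y hv.
  by rewrite /= mul1mx => <-.
apply/(@klein4_homP gT k x y (triv_repr k G) V v Gxy).
change (1%:M *m v = v *m V x /\ 1%:M *m v = v *m V y); rewrite !mul1mx.
split=> //; move: hv; rewrite Vx Vy -[v]hsubmxK /unip !mul_row_block.
rewrite !mulmx1 !mulmx0 !addr0 => /eq_row_mx[_ /(canRL (addrK _))].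
rewrite subrr; set a := lsubmx v => aE0.
suff -> : a = 0 by rewrite mul0mx add0r.
by rewrite -[a](mulmxK uE) aE0 mul0mx.
Qed.

(** The pair [(x, y)] need not be the pair [(s, t)] by which the module is
  given: the freedom to permute the three involutions reduces the three
  degenerate families of modules to one computation. *)
Lemma two_step_cohomology (N : kGmod) i :
    mx_rsim N V -> klein4_chi x y = klein4_chi s t ->
    E \in unitmx -> D + E \in unitmx ->
  rel_cohomology_dim (klein4_chi s t) N i (if i == 0%N then n else \rank D).
Proof.
move=> NV <- uE uDE; split.
  by apply: rel_resolution_exists; apply/set0Pn; exists <[x]>%G; apply: chi_x.
have splitN z F : V z = unip F -> F \in unitmx -> trace_split N z.
  by move=> Vz uF; apply: trace_split_rsim NV _; rewrite /trace_split Vz;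
     apply: unip_trace_split.
have splity := splitN _ _ Vy uE.
have splitxy : trace_split N (x * y)%g.
  by apply: splitN uDE; rewrite repr_mxMT Vx Vy unip_mul.
have dimG : \dim (hom_space (triv_repr k G) N) = n.
  by rewrite (dim_hom_rsim _ NV) dim_fixed.
have NVx : mx_rsim (res_repr <[x]>%G N) (res_repr <[x]>%G V).
  by case: NV => f dimN f_free homf; exists f => // g _; apply: homf; rewrite inE.
move=> Q; case: i => [|i] /=.
  have := dim_cohomology N Q 0; rewrite /= dimv0 addn0 => ->.
  by rewrite dim_cocycles_0.
have := dim_cohomology_S Gxy k2 splity splitxy Q i.
rewrite dimG (dim_hom_rsim _ NVx) => dimH.
have := dim_fixed_cycle Vx; lia.
Qed.

End TwoStepCohomology.

(** * Companion matrices *)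

Section Companion.

Variables (k : fieldType) (k2 : 2%N \in [pchar k]).

Definition theta_mx n (theta : {poly k}) : 'M[k]_n :=
  \matrix_(i < n, j < n)
    if i == 0%N :> nat then theta`_(n - j.+1) else (i == j.+1 :> nat)%:R.

Lemma row_theta_mx m (theta : {poly k}) lam (f : nat -> k) (j : 'I_m.+1) :
  ((\row_(i < m.+1) f i) *m (theta_mx m.+1 theta + lam%:M)) 0 j =
  f 0%N * theta`_(m - j) + (j < m)%:R * f j.+1 + lam * f j.
Proof.
rewrite mulmxDr mul_mx_scalar !mxE; congr (_ + _).
rewrite big_ord_recl !mxE /= subSS; congr (_ + _).
case: ltnP => [jm | mj].
  rewrite mul1r (bigD1 (Ordinal jm)) //= big1 ?addr0 => [|i ne_ij].
    by rewrite !mxE /= /bump add1n eqxx mulr1.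
  rewrite !mxE /= /bump add1n eqSS; case: eqP => [E|]; last by rewrite mulr0.
  by case/eqP: ne_ij; apply: val_inj.
rewrite mul0r big1 // => i _; rewrite !mxE /= /bump add1n eqSS.
by rewrite (ltn_eqF (leq_trans (ltn_ord i) mj)) mulr0.
Qed.

(** The partial values of Horner's scheme for evaluating a polynomial of
  degree [n] at [lam]. *)
Definition horner_partial n (theta : {poly k}) (lam : k) (j : nat) : k :=
  \sum_(l < j.+1) theta`_(n - l) * lam ^+ (j - l).

Lemma horner_partialS n theta lam j :
  horner_partial n theta lam j.+1 =
  lam * horner_partial n theta lam j + theta`_(n - j.+1).
Proof.
rewrite /horner_partial big_ord_recr /= subnn expr0 mulr1; congr (_ + _).
rewrite mulr_sumr; apply: eq_bigr => l _.
by rewrite subSn -1?ltnS // exprS mulrCA.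
Qed.

Lemma horner_partial_full n (theta : {poly k}) lam :
  size theta = n.+1 -> horner_partial n theta lam n = theta.[lam].
Proof.
move=> sz; rewrite horner_coef sz (reindex_inj rev_ord_inj) /=.
by apply: eq_bigr => l _; rewrite subSS.
Qed.

(** In characteristic 2 the row of partial Horner values is mapped by
  [theta_mx + lam] to [(0, ..., 0, theta(lam))], and a row annihilated by
  [theta_mx + lam] satisfies the recursion of the Horner scheme, hence is a
  multiple of that row. *)
Lemma rank_theta_mx m (theta : {poly k}) lam :
    size theta = m.+2 -> theta`_m.+1 = 1 ->
  \rank (theta_mx m.+1 theta + lam%:M)%R = (m + (theta.[lam] != 0)%R)%N.
Proof.
move=> sz lead1; set M := theta_mx _ _ + _.
have xx (a : k) : a + a = 0 by rewrite -mulr2n -mulr_natr (pcharf0 k2) mulr0.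
have eq2 (a b : k) : a + b = 0 -> a = b.
  by move=> ab; rewrite -[a]addr0 -(xx b) addrA ab add0r.
pose h := horner_partial m.+1 theta lam; pose w := \row_(j < m.+1) h j.
have h0 : h 0%N = 1 by rewrite /h /horner_partial big_ord1 subn0 lead1 mulr1.
have hS j : h j.+1 = lam * h j + theta`_(m - j).
  by rewrite /h horner_partialS subSS.
have wM (j : 'I_m.+1) : (w *m M) 0 j = (j == m :> nat)%:R * theta.[lam].
  rewrite row_theta_mx h0 mul1r; have := ltn_ord j; rewrite ltnS leq_eqVlt.
  case: eqVneq => [jm _ | _ /= jm].
    rewrite jm ltnn mul0r addr0 mul1r -(horner_partial_full lam sz).
    by rewrite horner_partialS subSS addrC.
  by rewrite jm mul1r mul0r hS addrAC [lam * _ + _]addrC xx.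
have ker_w (v : 'rV_m.+1) : v *m M = 0 -> v = v 0 0 *: w.
  move=> vM0; pose f j := v 0 (inord j).
  have def_v : v = \row_(j < m.+1) f j.
    by apply/rowP => j; rewrite mxE /f inord_val.
  have def_v0 : v 0 0 = f 0%N by congr (v 0 _); apply: val_inj; rewrite /= inordK.
  rewrite def_v0 {1}def_v; apply/rowP => j; rewrite !mxE.
  have : (j < m.+1)%N by []; elim: (j : nat) => [|i IHi] ltim.
    by rewrite h0 mulr1.
  have := row_theta_mx theta lam f (Ordinal (ltnW ltim)).
  rewrite -def_v vM0 mxE /= -ltnS ltim mul1r hS mulrDr mulrCA -IHi; last exact: ltnW.
  move=> E; apply: eq2; rewrite [RHS]E.
  by rewrite [lam * _ + _]addrC addrA (addrC (f i.+1)).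
have w0 : w != 0.
  by apply/eqP => /rowP/(_ 0); rewrite !mxE h0; apply/eqP/oner_neq0.
have ker_sub : (kermx M <= w)%MS.
  apply/row_subP => i; rewrite (ker_w (row i (kermx M))) ?scalemx_sub //.
  by rewrite -row_mul mulmx_ker row0.
have rankM : (\rank M + \rank (kermx M))%N = m.+1.
  by rewrite mxrank_ker subnKC // rank_leq_row.
case: eqVneq => [th0 | th_n0] /=.
  have ker_ge : (w <= kermx M)%MS.
    by apply/sub_kermxP/rowP => j; rewrite wM th0 mulr0 mxE.
  have : \rank (kermx M) = 1%N.
    rewrite (eqmx_rank (B := w)); first by rewrite rank_rV w0.
    by rewrite ker_sub ker_ge.
  by move=> r1; move: rankM; rewrite r1 addn1 addn0 => -[].
have /eqP: kermx M == 0.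
  rewrite -submx0; apply/row_subP => i; set v := row i _.
  have vM0 : v *m M = 0 by rewrite -row_mul mulmx_ker row0.
  have /rowP/(_ ord_max) := vM0; rewrite (ker_w _ vM0) -scalemxAl mxE wM eqxx.
  rewrite mul1r [RHS]mxE => /eqP; rewrite mulf_eq0 (negPf th_n0) orbF => /eqP->.
  by rewrite scale0r sub0mx.
by move=> ker0; move: rankM; rewrite ker0 mxrank0 addn0 addn1.
Qed.

End Companion.

(** * Powers of irreducible polynomials and the main theorem *)

Section IrreduciblePowers.

Variables (k : fieldType) (k2 : 2%N \in [pchar k]).

Lemma irr_power_root n (theta : {poly k}) lam :
  irr_power n theta -> root theta lam -> theta = ('X - lam%:P) ^+ n.
Proof.
case=> sz [p [e [p_monic [_ p_irr] def_theta]]].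
rewrite def_theta /root horner_exp expf_eq0 => /andP[_ p_root].
have /eqp_eq : ('X - lam%:P %= p)%R.
  by apply: p_irr; rewrite ?size_XsubC // dvdp_XsubCl.
rewrite (monicP p_monic) (monicP (monicXsubC lam)) !scale1r => def_p.
by move: sz; rewrite def_theta -def_p size_exp_XsubC => -[->].
Qed.

Lemma irr_power_lead n (theta : {poly k}) : irr_power n theta -> theta`_n = 1.
Proof.
case=> sz [p [e [p_monic _ def_theta]]].
have : theta \is monic by rewrite def_theta monic_exp.
by rewrite monicE lead_coefE sz => /eqP.
Qed.

Lemma theta_mx_unit m (theta : {poly k}) lam :
    size theta = m.+2 -> theta`_m.+1 = 1 -> theta.[lam] != 0 ->
  (theta_mx m.+1 theta + lam%:M)%R \in unitmx.
Proof.
move=> sz lead1 th_n0; rewrite -row_full_unit /row_full.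
by rewrite (rank_theta_mx k2 lam sz lead1) th_n0 addn1.
Qed.

End IrreduciblePowers.

Theorem proposition19 (gT : finGroupType) (s t : gT) (Gst : klein4 s t)
    (k : fieldType) (k2 : 2%N \in [pchar k])
    (N : representation k [set: gT]%G)
    (N_even : ~~ odd (rdegree N))
    (N_indec : indecomposable N)
    (N_nproj : ~ rel_projective (klein4_chi s t) N)
    (n : nat) (n_gt0 : (0 < n)%N) :
  (mx_rsim N (V_infty Gst k2 n)
     \/ mx_rsim N (V_theta Gst k2 n 'X^n)
     \/ mx_rsim N (V_theta Gst k2 n (('X + 1) ^+ n)) ->
   forall i : nat,
     rel_cohomology_dim (klein4_chi s t) N i (if i == 0%N then n else n.-1))
  /\
  (forall theta : {poly k}, irr_power n theta ->
     theta <> 'X^n -> theta <> ('X + 1) ^+ n ->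
     mx_rsim N (V_theta Gst k2 n theta) ->
   forall i : nat, rel_cohomology_dim (klein4_chi s t) N i n).
Proof.
case: n n_gt0 => // m _ {N_even N_indec N_nproj}.
have two0 : 1 + 1 = 0 :> k by rewrite -mulr2n (pcharf0 k2).
have X1 : 'X + 1 = 'X - 1%:P :> {poly k}.
  by congr (_ + _); apply/eqP; rewrite -subr_eq0 opprK -polyCD two0.
have sizeX : size ('X^(m.+1) : {poly k}) = m.+2 by rewrite size_polyXn.
have leadX : ('X^(m.+1) : {poly k})`_m.+1 = 1 by rewrite coefXn eqxx.
have X_0 : ('X^(m.+1) : {poly k}).[0] = 0 by rewrite hornerXn expr0n.
have X_1 : ('X^(m.+1) : {poly k}).[1] = 1 by rewrite hornerXn expr1n.
have add0M (M : 'M[k]_m.+1) : M + 0%:M = M by rewrite raddf0 addr0.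
split=> [|theta th_irr th_n0 th_n1 NV i].
  case=> [NV | [NV | NV]] i.
  - (* [t] acts by the transpose of the companion matrix of [X^n], [s] by the
       identity matrix, so the roles of [s] and [t] are exchanged. *)
    pose S := (theta_mx m.+1 ('X^(m.+1) : {poly k}))^T.
    have defS : S = \matrix_(i < m.+1, j < m.+1) (j == i.+1 :> nat)%:R.
      apply/matrixP => a b; rewrite !mxE coefXn; case: ifP => //.
      move=> /eqP b0; rewrite b0 subSS (ltn_eqF (leq_ltn_trans (leq_subr _ _) _)) //.
    have rankS : \rank S = m.
      rewrite mxrank_tr -[theta_mx _ _]add0M (rank_theta_mx k2 0 sizeX leadX).
      by rewrite X_0 eqxx addn0.
    have uS1 : S + 1%:M \in unitmx.
      rewrite -tr_scalar_mx -linearD unitmx_tr; apply: theta_mx_unit => //.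
      by rewrite X_1 oner_neq0.
    have Vt := two_step_tE k2 Gst 1%:M S; have Vs := two_step_sE k2 Gst 1%:M S.
    have := two_step_cohomology (klein4_sym Gst) Vt Vs i _ (klein4_chi_sym Gst)
              (unitmx1 _ _) uS1.
    by rewrite rankS; apply; rewrite defS.
  - have Vt := two_step_tE k2 Gst (theta_mx m.+1 'X^(m.+1)) 1%:M.
    have Vs := two_step_sE k2 Gst (theta_mx m.+1 'X^(m.+1)) 1%:M.
    have := two_step_cohomology Gst Vs Vt i NV (erefl _) (unitmx1 _ _).
    rewrite -{2}[theta_mx _ _]add0M (rank_theta_mx k2 0 sizeX leadX).
    rewrite X_0 eqxx addn0; apply; apply: theta_mx_unit => //.
    by rewrite X_1 oner_neq0.
  (* Here it is [s * t] over which the module is not free. *)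
  rewrite X1 in NV; set th := ('X - _) ^+ _ in NV.
  have sz : size th = m.+2 by rewrite size_exp_XsubC.
  have lead1 : th`_m.+1 = 1.
    have : th \is monic by rewrite monic_exp // monicXsubC.
    by rewrite monicE lead_coefE sz => /eqP.
  have th0 : th.[0] != 0.
    by rewrite horner_exp hornerXsubC sub0r expf_neq0 // oppr_eq0 oner_neq0.
  have th1 : th.[1] = 0 by rewrite horner_exp hornerXsubC subrr expr0n.
  have Vs := two_step_sE k2 Gst (theta_mx m.+1 th) 1%:M.
  have Vt := two_step_tE k2 Gst (theta_mx m.+1 th) 1%:M.
  have Vst : two_step_repr Gst k2 (theta_mx m.+1 th) 1%:M (s * t)%g =
             unip (theta_mx m.+1 th + 1%:M).
    by rewrite repr_mxMT Vs Vt unip_mul.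
  have := two_step_cohomology (klein4_shear Gst) Vst Vt i NV
            (klein4_chi_shear Gst) (unitmx1 _ _).
  rewrite (rank_theta_mx k2 1 sz lead1) th1 eqxx addn0; apply.
  rewrite -addrA (addmx_pchar2 k2) -[0](raddf0 (@scalar_mx k m.+1)).
  exact: theta_mx_unit.
have Vt := two_step_tE k2 Gst (theta_mx m.+1 theta) 1%:M.
have Vs := two_step_sE k2 Gst (theta_mx m.+1 theta) 1%:M.
have [sz _] := th_irr; have lead1 := irr_power_lead th_irr.
have th0 : theta.[0] != 0.
  apply/eqP => th0; apply: th_n0; rewrite (irr_power_root (lam := 0) th_irr).
    by rewrite polyC0 subr0.
  exact/rootP.
have th1 : theta.[1] != 0.
  apply/eqP => th1; apply: th_n1; rewrite X1; apply: irr_power_root => //.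
  exact/rootP.
have := two_step_cohomology Gst Vs Vt i NV (erefl _) (unitmx1 _ _).
rewrite -{2}[theta_mx _ _]add0M (rank_theta_mx k2 0 sz lead1) th0 addn1 if_same.
by apply; apply: theta_mx_unit.
Qed.
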